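(* Let $c,v$ be independent indeterminates over $\mathbb{Q}$ and let $K,L,M,N,P\in\mathbb{Q}(c,v)$ be the polynomials given in the context. Then the curve $$H:\ Y^2=KX^4+LX^3+MX^2+NX+P$$ over $\mathbb{Q}(c,v)$ is birationally equivalent over $\mathbb{Q}(c,v)$ to the elliptic curve $$\chi:\ V^2=U^3-27IU-27J,$$ where $I=12KP-3LN+M^2$ and $J=72KMP+9LMN-27KN^2-27L^2P-2M^3$, and the rank of $\chi(\mathbb{Q}(c,v))$ is at least $1$.
   Context: The coefficients are: $K=\big[(c+1)(3c^2+3c+1)(3c^2+6c+4)(3c^2+9c+7)(c^2+2c+3)\big]^2$; $L=-24(c+1)(c^2+2c+3)(3c^2+3c+1)(3c^2+4)(3c^2+6c+4)(3c^2+9c+7)^2(c^2-c+1)(3c^3+3c^2+27c+1)\,v+32c(c+1)(c^2+2c+3)(3c^2+3c+1)(3c^2+4)(3c^2+6c+4)^2(3c^2+9c+7)(c^2+8)(3c^2-6c+4)$; $M=6(1215c^{14}+4131c^{13}+24543c^{12}+49383c^{11}+134460c^{10}+152118c^{9}+263619c^{8}+229491c^{7}+297153c^{6}+223859c^{5}+208374c^{4}+123018c^{3}+52116c^{2}+16504c+480)(3c^2+9c+7)^2v^2-24(c^2+c+1)(3c^2+4)(3c^2+6c+4)(3c^2+9c+7)(189c^{10}+2340c^8-1530c^7+7383c^6-9918c^5+7365c^4+740c^3-246c^2+1552c+21)v+2(2835c^{14}-8424c^{13}+37881c^{12}-109188c^{11}+156276c^{10}-373032c^{9}+395718c^{8}-344976c^{7}+374198c^{6}-336324c^{5}-98956c^{4}-407760c^{3}-243937c^{2}+2688c+441)(3c^2+6c+4)^2$;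 $N=-72(c^2+c+1)(3c^2+4)(c^2-c+1)(3c^2+1)(3c^3+6c^2+18c+8)(3c^3+3c^2+27c+1)(3c^2+9c+7)^2v^3+48(c^2+c+1)(3c^2+4)(3c^2+6c+4)(3c^2+9c+7)(27c^{10}+450c^8-450c^7+2019c^6-1494c^5+2325c^4-1180c^3-1398c^2+16c+21)v^2+24(c^2+c+1)(3c^2+4)(3c^2+6c+4)(3c^2+9c+7)(135c^{10}+1440c^8-630c^7+3345c^6-6930c^5+2715c^4+3100c^3+2550c^2+1520c-21)v-96c(c^2+c+1)(3c^2+4)(3c^2-3c+1)(3c^2-6c+4)(3c^3+3c^2+15c+7)(c^2+8)(3c^2+6c+4)^2$; $P=\big[3(c^2+c+1)(3c^2-3c+1)(3c^2+6c+4)(3c^3+3c^2+15c+7)\big]^2+72(3c^2-3c+1)(3c^2+4)(3c^2+6c+4)(3c^2-9c+7)(3c^3+3c^2+15c+7)(3c^3-3c^2+27c-1)(c^2+c+1)^2v-18(6561c^{14}+2187c^{13}+91125c^{12}+42039c^{11}+287712c^{10}-5994c^{9}-224127c^{8}+6399c^{7}+316035c^{6}+232191c^{5}+1581642c^{4}+299082c^{3}+294228c^{2}+248472c-7840)(c^2+c+1)^2v^2+72(3c^2+1)(3c^2+4)(3c^2+9c+7)(3c^2-9c+7)(3c^3-3c^2+27c-1)(3c^3+6c^2+18c+8)(c^2+c+1)^2v^3+\big[3(c^2+c+1)(3c^2+1)(3c^2+9c+7)(3c^3+6c^2+18c+8)\big]^2v^4$. (These arise as follows: for rational points $((c-1)^3,p),(c^3,q),((c+1)^3,r),((c+2)^3,s),((c-2)^3,t)$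 on $y^2=kx^3+lx+m$, with $p,q,r,s$ parametrized quadratically in $u,v,w$, the condition on $t$ becomes $t^2=Ku^4+Lu^3+Mu^2+Nu+P$, homogeneous in $v,w$; here $w=1$.) *)

(* Defs.v *)
From mathcomp Require Import all_boot all_order all_algebra.

Set Implicit Arguments.
Unset Strict Implicit.
Unset Printing Implicit Defensive.

Import GRing.Theory.
Local Open Scope ring_scope.

(* Q(c, v) as the fraction field of Q[c][v]. *)
Definition Qcv := {fraction {poly {poly rat}}}.
Definition indet_c : Qcv := tofrac ('X%:P : {poly {poly rat}}).
Definition indet_v : Qcv := tofrac ('X : {poly {poly rat}}).

Section Coefficients.
Variables (R : comNzRingType) (c v : R).

Definition coeff_K : R :=
  ((c + 1) * (3 * c ^+ 2 + 3 * c + 1) * (3 * c ^+ 2 + 6 * c + 4)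
    * (3 * c ^+ 2 + 9 * c + 7) * (c ^+ 2 + 2 * c + 3)) ^+ 2.

Definition coeff_L : R :=
  - 24 * (c + 1) * (c ^+ 2 + 2 * c + 3) * (3 * c ^+ 2 + 3 * c + 1)
    * (3 * c ^+ 2 + 4)
    * (3 * c ^+ 2 + 6 * c + 4) * (3 * c ^+ 2 + 9 * c + 7) ^+ 2
    * (c ^+ 2 - c + 1)
    * (3 * c ^+ 3 + 3 * c ^+ 2 + 27 * c + 1) * v
  + 32 * c * (c + 1) * (c ^+ 2 + 2 * c + 3) * (3 * c ^+ 2 + 3 * c + 1)
    * (3 * c ^+ 2 + 4) * (3 * c ^+ 2 + 6 * c + 4) ^+ 2
    * (3 * c ^+ 2 + 9 * c + 7)
    * (c ^+ 2 + 8) * (3 * c ^+ 2 - 6 * c + 4).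

Definition coeff_M : R :=
  6
    * (1215%:R * c ^+ 14 + 4131%:R * c ^+ 13 + 24543%:R * c ^+ 12
       + 49383%:R * c ^+ 11 + 134460%:R * c ^+ 10 + 152118%:R * c ^+ 9
       + 263619%:R * c ^+ 8 + 229491%:R * c ^+ 7 + 297153%:R * c ^+ 6
       + 223859%:R * c ^+ 5 + 208374%:R * c ^+ 4 + 123018%:R * c ^+ 3
       + 52116%:R * c ^+ 2 + 16504%:R * c + 480%:R)
    * (3 * c ^+ 2 + 9 * c + 7) ^+ 2 * v ^+ 2
  - 24 * (c ^+ 2 + c + 1) * (3 * c ^+ 2 + 4) * (3 * c ^+ 2 + 6 * c + 4)
    * (3 * c ^+ 2 + 9 * c + 7)
    * (189%:R * c ^+ 10 + 2340%:R * c ^+ 8 - 1530%:R * c ^+ 7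
       + 7383%:R * c ^+ 6 - 9918%:R * c ^+ 5 + 7365%:R * c ^+ 4
       + 740%:R * c ^+ 3 - 246%:R * c ^+ 2 + 1552%:R * c + 21%:R)
    * v
  + 2
    * (2835%:R * c ^+ 14 - 8424%:R * c ^+ 13 + 37881%:R * c ^+ 12
       - 109188%:R * c ^+ 11 + 156276%:R * c ^+ 10 - 373032%:R * c ^+ 9
       + 395718%:R * c ^+ 8 - 344976%:R * c ^+ 7 + 374198%:R * c ^+ 6
       - 336324%:R * c ^+ 5 - 98956%:R * c ^+ 4 - 407760%:R * c ^+ 3
       - 243937%:R * c ^+ 2 + 2688%:R * c + 441%:R)
    * (3 * c ^+ 2 + 6 * c + 4) ^+ 2.

Definition coeff_N : R :=
  - 72 * (c ^+ 2 + c + 1) * (3 * c ^+ 2 + 4) * (c ^+ 2 - c + 1)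
    * (3 * c ^+ 2 + 1)
    * (3 * c ^+ 3 + 6 * c ^+ 2 + 18 * c + 8)
    * (3 * c ^+ 3 + 3 * c ^+ 2 + 27 * c + 1)
    * (3 * c ^+ 2 + 9 * c + 7) ^+ 2 * v ^+ 3
  + 48 * (c ^+ 2 + c + 1) * (3 * c ^+ 2 + 4) * (3 * c ^+ 2 + 6 * c + 4)
    * (3 * c ^+ 2 + 9 * c + 7)
    * (27%:R * c ^+ 10 + 450%:R * c ^+ 8 - 450%:R * c ^+ 7
       + 2019%:R * c ^+ 6 - 1494%:R * c ^+ 5 + 2325%:R * c ^+ 4
       - 1180%:R * c ^+ 3 - 1398%:R * c ^+ 2 + 16%:R * c + 21%:R)
    * v ^+ 2
  + 24 * (c ^+ 2 + c + 1) * (3 * c ^+ 2 + 4) * (3 * c ^+ 2 + 6 * c + 4)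
    * (3 * c ^+ 2 + 9 * c + 7)
    * (135%:R * c ^+ 10 + 1440%:R * c ^+ 8 - 630%:R * c ^+ 7
       + 3345%:R * c ^+ 6 - 6930%:R * c ^+ 5 + 2715%:R * c ^+ 4
       + 3100%:R * c ^+ 3 + 2550%:R * c ^+ 2 + 1520%:R * c - 21%:R)
    * v
  - 96 * c * (c ^+ 2 + c + 1) * (3 * c ^+ 2 + 4) * (3 * c ^+ 2 - 3 * c + 1)
    * (3 * c ^+ 2 - 6 * c + 4) * (3 * c ^+ 3 + 3 * c ^+ 2 + 15 * c + 7)
    * (c ^+ 2 + 8)
    * (3 * c ^+ 2 + 6 * c + 4) ^+ 2.

Definition coeff_P : R :=
  (3 * (c ^+ 2 + c + 1) * (3 * c ^+ 2 - 3 * c + 1) * (3 * c ^+ 2 + 6 * c + 4)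
    * (3 * c ^+ 3 + 3 * c ^+ 2 + 15 * c + 7)) ^+ 2
  + 72 * (3 * c ^+ 2 - 3 * c + 1) * (3 * c ^+ 2 + 4)
    * (3 * c ^+ 2 + 6 * c + 4)
    * (3 * c ^+ 2 - 9 * c + 7) * (3 * c ^+ 3 + 3 * c ^+ 2 + 15 * c + 7)
    * (3 * c ^+ 3 - 3 * c ^+ 2 + 27 * c - 1) * (c ^+ 2 + c + 1) ^+ 2 * v
  - 18
    * (6561%:R * c ^+ 14 + 2187%:R * c ^+ 13 + 91125%:R * c ^+ 12
       + 42039%:R * c ^+ 11 + 287712%:R * c ^+ 10 - 5994%:R * c ^+ 9
       - 224127%:R * c ^+ 8 + 6399%:R * c ^+ 7 + 316035%:R * c ^+ 6
       + 232191%:R * c ^+ 5 + 1581642%:R * c ^+ 4 + 299082%:R * c ^+ 3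
       + 294228%:R * c ^+ 2 + 248472%:R * c - 7840%:R)
    * (c ^+ 2 + c + 1) ^+ 2 * v ^+ 2
  + 72 * (3 * c ^+ 2 + 1) * (3 * c ^+ 2 + 4) * (3 * c ^+ 2 + 9 * c + 7)
    * (3 * c ^+ 2 - 9 * c + 7) * (3 * c ^+ 3 - 3 * c ^+ 2 + 27 * c - 1)
    * (3 * c ^+ 3 + 6 * c ^+ 2 + 18 * c + 8) * (c ^+ 2 + c + 1) ^+ 2 * v ^+ 3
  + (3 * (c ^+ 2 + c + 1) * (3 * c ^+ 2 + 1) * (3 * c ^+ 2 + 9 * c + 7)
    * (3 * c ^+ 3 + 6 * c ^+ 2 + 18 * c + 8)) ^+ 2 * v ^+ 4.

End Coefficients.

Section QuarticInvariants.
Variables (R : comNzRingType) (K L M N P : R).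

Definition invI : R := 12 * K * P - 3 * L * N + M ^+ 2.

Definition invJ : R :=
  72 * K * M * P + 9 * L * M * N - 27 * K * N ^+ 2
  - 27 * L ^+ 2 * P - 2 * M ^+ 3.

End QuarticInvariants.

(* Affine plane curves over a field k are given by an equation f = 0 with
   f : {poly {poly k}}.  As in polyXY, 'X is the outer variable and
   'Y := 'X%:P the inner one, and p.[x, y] substitutes x for 'X, y for 'Y. *)
Section PlaneCurves.
Variable k : fieldType.

Definition quartic_curve (K L M N P : k) : {poly {poly k}} :=
  'Y ^+ 2 - (K%:P%:P * 'X ^+ 4 + L%:P%:P * 'X ^+ 3 + M%:P%:P * 'X ^+ 2
             + N%:P%:P * 'X + P%:P%:P).

Definition weierstrass_curve (A B : k) : {poly {poly k}} :=
  'Y ^+ 2 - ('X ^+ 3 + A%:P%:P * 'X + B%:P%:P).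

(* The rational map (x, y) |-> (num1/den1, num2/den2), defined over k. *)
Record ratmap := RatMap {
  num1 : {poly {poly k}}; den1 : {poly {poly k}};
  num2 : {poly {poly k}}; den2 : {poly {poly k}} }.

Section GeometricPoints.
Variables (Omega : fieldType) (iota : {rmorphism k -> Omega}).

Definition eval2 (p : {poly {poly k}}) (z : Omega * Omega) : Omega :=
  (map_poly (map_poly iota) p).[z.1, z.2].

Definition on_curve (f : {poly {poly k}}) (z : Omega * Omega) : Prop :=
  eval2 f z = 0.

Definition regular_at (phi : ratmap) (z : Omega * Omega) : Prop :=
  eval2 (den1 phi) z != 0 /\ eval2 (den2 phi) z != 0.

Definition ratmap_app (phi : ratmap) (z : Omega * Omega) : Omega * Omega :=
  (eval2 (num1 phi) z / eval2 (den1 phi) z,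
   eval2 (num2 phi) z / eval2 (den2 phi) z).

(* Q holds on a dense open subset of the curve f = 0: the nonempty open
   subsets of an irreducible curve are the complements of finite sets. *)
Definition generically (f : {poly {poly k}}) (Q : Omega * Omega -> Prop) :=
  exists s : seq (Omega * Omega),
    forall z, on_curve f z -> z \notin s -> Q z.

Definition is_ratmap (f g : {poly {poly k}}) (phi : ratmap) : Prop :=
  generically f (regular_at phi) /\
  (forall z, on_curve f z -> regular_at phi z -> on_curve g (ratmap_app phi z)).

Definition left_inverse_ratmap (f : {poly {poly k}}) (phi psi : ratmap) : Prop :=
  generically f (fun z => [/\ regular_at phi z,
                              regular_at psi (ratmap_app phi z)
                            & ratmap_app psi (ratmap_app phi z) = z]).

End GeometricPoints.

(* Mutually inverse rational maps with coefficients in k between the curves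
   f = 0 and g = 0; points are taken in an algebraic closure of k, that is, an
   algebraically closed field which is algebraic (integralRange) over k. *)
Definition birationally_equivalent (f g : {poly {poly k}}) : Prop :=
  exists phi psi : ratmap,
    forall (Omega : closedFieldType) (iota : {rmorphism k -> Omega}),
      integralRange iota ->
      [/\ is_ratmap iota f g phi, is_ratmap iota g f psi,
          left_inverse_ratmap iota f phi psi
        & left_inverse_ratmap iota g psi phi].

End PlaneCurves.

(* The curve y^2 = x^3 + A x + B over a field k of characteristic not 2 or 3,
   with None as the point at infinity. *)
Section EllipticCurves.
Variables (k : fieldType) (A B : k).

Definition is_elliptic : Prop := 4 * A ^+ 3 + 27 * B ^+ 2 != 0.

Definition ec_point : Type := option (k * k).

Definition ec_rational (p : ec_point) : Prop :=
  if p is Some (x, y) then y ^+ 2 = x ^+ 3 + A * x + B else True.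

Definition ec_opp (p : ec_point) : ec_point :=
  if p is Some (x, y) then Some (x, - y) else None.

Definition ec_chord (slope x1 y1 x2 : k) : ec_point :=
  let x3 := slope ^+ 2 - x1 - x2 in Some (x3, slope * (x1 - x3) - y1).

Definition ec_add (p q : ec_point) : ec_point :=
  match p, q with
  | None, _ => q
  | _, None => p
  | Some (x1, y1), Some (x2, y2) =>
      if x1 != x2 then ec_chord ((y2 - y1) / (x2 - x1)) x1 y1 x2
      else if y1 == - y2 then None
      else ec_chord ((3 * x1 ^+ 2 + A) / (2 * y1)) x1 y1 x2
  end.

Definition ec_mulz (m : int) (p : ec_point) : ec_point :=
  match m with
  | Posz n => iter n (ec_add p) None
  | Negz n => ec_opp (iter n.+1 (ec_add p) None)
  end.

(* The rank of the group of k-rational points is the maximal number of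
   Z-linearly independent points. *)
Definition ec_independent (r : nat) (p : 'I_r -> ec_point) : Prop :=
  forall m : 'I_r -> int,
    \big[ec_add/None]_(i < r) ec_mulz (m i) (p i) = None ->
    forall i, m i = 0.

Definition ec_rank_ge (r : nat) : Prop :=
  exists p : 'I_r -> ec_point,
    (forall i, ec_rational (p i)) /\ ec_independent p.

End EllipticCurves.

(* Main.v *)
Require Import Defs.
From mathcomp Require Import all_boot all_order all_algebra.
From mathcomp Require Import ring.
Import GRing.Theory Num.Theory.
Local Open Scope ring_scope.

Set Implicit Arguments.
Unset Strict Implicit.

(* The leading coefficient is a square, [K = a^2], so the quartic can be written
   [Y^2 = G^2 + e X + f] with [G = a X^2 + b X + d].  Putting [W = Y + G], the
   equation [2 G W = W^2 - e X - f] becomes, after multiplication by [W], a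
   Weierstrass equation in [W] and [Z = X W]; hence both birational maps.  The
   point at infinity of the quartic on the branch [Y ~ - a X^2] becomes, up to
   sign, the point [(3 (3 b^2 - 2 M), 27 (a N - b (M - b^2)))] with [W = 0].

   At [(c, v) = (-1/2, 0)] the Weierstrass curve degenerates to a nodal cubic
   [y^2 = (x - alpha)^2 (x + 2 alpha)].  With [z = y / (x - alpha)] the group
   law there is [(z1 z2 + 3 alpha) / (z1 + z2)], so the multiples of the point
   reduce to [q_(n+1) / q_n - z] for a Lucas sequence [q].  Up to scaling its
   terms are odd integers, hence nonzero: no multiple vanishes, and apart from
   the first doubling only chord additions are met. *)

(** * Compatibility of the invariants and of plane evaluation with ring morphisms *)

Section InvariantMorphism.
Variables (R S : comNzRingType) (h : {rmorphism R -> S}) (K L M N P : R).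

Lemma rmorph_invI : h (invI K L M N P) = invI (h K) (h L) (h M) (h N) (h P).
Proof. by rewrite /invI !(rmorph_nat, rmorphXn, rmorphB, rmorphD, rmorphM). Qed.

Lemma rmorph_invJ : h (invJ K L M N P) = invJ (h K) (h L) (h M) (h N) (h P).
Proof. by rewrite /invJ !(rmorph_nat, rmorphXn, rmorphB, rmorphD, rmorphM). Qed.

End InvariantMorphism.

Section Eval2.
Variables (k Omega : fieldType) (iota : {rmorphism k -> Omega}).
Variable z : Omega * Omega.

Lemma eval2D p q : eval2 iota (p + q) z = eval2 iota p z + eval2 iota q z.
Proof. by rewrite /eval2 rmorphD !hornerD. Qed.

Lemma eval2N p : eval2 iota (- p) z = - eval2 iota p z.
Proof. by rewrite /eval2 rmorphN !hornerN. Qed.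

Lemma eval2M p q : eval2 iota (p * q) z = eval2 iota p z * eval2 iota q z.
Proof. by rewrite /eval2 rmorphM !hornerM. Qed.

Lemma eval2Xn p n : eval2 iota (p ^+ n) z = eval2 iota p z ^+ n.
Proof. by rewrite /eval2 rmorphXn !horner_exp. Qed.

Lemma eval2X : eval2 iota 'X z = z.1.
Proof. by rewrite /eval2 map_polyX hornerX hornerC. Qed.

Lemma eval2Y : eval2 iota 'Y z = z.2.
Proof. by rewrite /eval2 map_polyC hornerC /= map_polyX hornerX. Qed.

Lemma eval2C a : eval2 iota a%:P%:P z = iota a.
Proof. by rewrite /eval2 map_polyC hornerC /= map_polyC hornerC. Qed.

Definition eval2E := (eval2Xn, eval2C, eval2X, eval2Y, eval2D, eval2N, eval2M).

End Eval2.

(** * Birational maps for a quartic whose leading coefficient is a square *)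

Section SquareLeadingCoefficient.
Variables (k : fieldType) (a b d e f : k).

Let H : {poly {poly k}} :=
  quartic_curve (a ^+ 2) (2 * a * b) (b ^+ 2 + 2 * a * d)
    (2 * b * d + e) (d ^+ 2 + f).
Let A : k :=
  - 27 * invI (a ^+ 2) (2 * a * b) (b ^+ 2 + 2 * a * d)
    (2 * b * d + e) (d ^+ 2 + f).
Let B : k :=
  - 27 * invJ (a ^+ 2) (2 * a * b) (b ^+ 2 + 2 * a * d)
    (2 * b * d + e) (d ^+ 2 + f).
Let E : {poly {poly k}} := weierstrass_curve A B.

(** Completing the square in [Z = X W] gives the ordinate [27 a (4 a Z + 2 b W + e)]. The scaling
    [18 a] makes the cubic monic and the shift [3 (b^2 - 4 a d)] removes its quadratic term. *)
Definition quartic_to_weierstrass : ratmap k :=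
  let W : {poly {poly k}} := 'Y + a%:P%:P * 'X ^+ 2 + b%:P%:P * 'X + d%:P%:P in
  RatMap ((18 * a)%:P%:P * W + (3 * (b ^+ 2 - 4 * a * d))%:P%:P) 1%:P%:P
    ((54 * a)%:P%:P * ((2 * a)%:P%:P * 'X + b%:P%:P) * W + (27 * a * e)%:P%:P)
    1%:P%:P.

(** Here [W] is [18 a] times the [W] of the forward map. The first quotient recovers [X], and the
    second is [Y = W / (18 a) - (a X^2 + b X + d)] over a common denominator. *)
Definition weierstrass_to_quartic : ratmap k :=
  let W : {poly {poly k}} := 'X - (3 * (b ^+ 2 - 4 * a * d))%:P%:P in
  let n : {poly {poly k}} := 'Y - (27 * a * e)%:P%:P - (3 * b)%:P%:P * W in
  RatMap n ((6 * a)%:P%:P * W)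
    (2%:P%:P * W ^+ 3 - n ^+ 2 - (6 * b)%:P%:P * n * W
       - (36 * a * d)%:P%:P * W ^+ 2)
    ((36 * a)%:P%:P * W ^+ 2).

Hypotheses (two_neq0 : 2 != 0 :> k) (three_neq0 : 3 != 0 :> k).
Hypothesis a_neq0 : a != 0.
Hypothesis AB_elliptic : is_elliptic A B.

(** If [e = f = 0], the quartic is a perfect square and the discriminant vanishes. *)
Lemma residual_neq0 : e = 0 -> f != 0.
Proof.
move=> e0; apply: contraNneq AB_elliptic => f0.
by apply/eqP; rewrite /A /B /invI /invJ e0 f0; ring.
Qed.

Section Points.
Variables (Omega : fieldType) (iota : {rmorphism k -> Omega}).

Let a' := iota a.
Let b' := iota b.
Let d' := iota d.
Let e' := iota e.
Let f' := iota f.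

Let W x y := y + a' * x ^+ 2 + b' * x + d'.
Let U0 := 3 * (b' ^+ 2 - 4 * a' * d').

Lemma on_quarticE x y : on_curve iota H (x, y) <->
  y ^+ 2 = (a' * x ^+ 2 + b' * x + d') ^+ 2 + e' * x + f'.
Proof.
rewrite /on_curve /H /quartic_curve !eval2E /=.
rewrite !(rmorph_nat, rmorphXn, rmorphD, rmorphM) /= -/a' -/b' -/d' -/e' -/f'.
split=> [/eqP|->]; last by ring.
by rewrite subr_eq0 => /eqP ->; ring.
Qed.

Lemma on_weierstrassE u v : on_curve iota E (u, v) <->
  v ^+ 2 = (u - U0) ^+ 3 + (9 * b' ^+ 2 - 36 * a' * d') * (u - U0) ^+ 2
    + 81 * (2 * a' * b' * e' - 4 * a' ^+ 2 * f') * (u - U0)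
    + (27 * a' * e') ^+ 2.
Proof.
rewrite /on_curve /E /weierstrass_curve !eval2E /= /A /B.
rewrite !(rmorphM _ (- 27)) rmorphN rmorph_nat rmorph_invI rmorph_invJ.
rewrite !(rmorph_nat, rmorphXn, rmorphD, rmorphM) /= -/a' -/b' -/d' -/e' -/f'.
rewrite /invI /invJ /U0.
split=> [/eqP|->]; last by ring.
by rewrite subr_eq0 => /eqP ->; ring.
Qed.

Lemma quartic_to_weierstrassE x y :
  ratmap_app iota quartic_to_weierstrass (x, y) =
  (18 * a' * W x y + U0, 54 * a' * (2 * a' * x + b') * W x y + 27 * a' * e').
Proof.
rewrite /ratmap_app /= !eval2E /=.
rewrite ?(rmorph_nat, rmorphXn, rmorphB, rmorphD, rmorphM, rmorph1) /=.
by rewrite !divr1.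
Qed.

Let n u v := v - 27 * a' * e' - 3 * b' * (u - U0).

Lemma weierstrass_to_quarticE u v :
  ratmap_app iota weierstrass_to_quartic (u, v) =
  (n u v / (6 * a' * (u - U0)),
   (2 * (u - U0) ^+ 3 - n u v ^+ 2 - 6 * b' * n u v * (u - U0)
      - 36 * a' * d' * (u - U0) ^+ 2) / (36 * a' * (u - U0) ^+ 2)).
Proof.
rewrite /ratmap_app /= !eval2E /=.
by rewrite ?(rmorph_nat, rmorphXn, rmorphB, rmorphD, rmorphM) /=.
Qed.

Lemma quartic_to_weierstrass_regular z :
  regular_at iota quartic_to_weierstrass z.
Proof. by rewrite /regular_at /= !eval2E rmorph1 oner_neq0. Qed.

Let two_neq0' : 2 != 0 :> Omega.
Proof. by rewrite -(rmorph_nat iota) fmorph_eq0. Qed.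

Let three_neq0' : 3 != 0 :> Omega.
Proof. by rewrite -(rmorph_nat iota) fmorph_eq0. Qed.

Let a_neq0' : a' != 0.
Proof. by rewrite fmorph_eq0. Qed.

Let mul23_neq0 i j : (2 ^ i * 3 ^ j)%:R != 0 :> Omega.
Proof. by rewrite natrM !natrX mulf_neq0 // expf_neq0. Qed.

Lemma weierstrass_to_quartic_regular u v :
  regular_at iota weierstrass_to_quartic (u, v) <-> u != U0.
Proof.
rewrite /regular_at /= !eval2E /=.
rewrite ?(rmorph_nat, rmorphXn, rmorphB, rmorphD, rmorphM) /=.
rewrite -/a' -/b' -/d' -/U0.
rewrite -[u == U0]subr_eq0 !(expf_eq0, mulf_eq0) /=.
rewrite (negbTE (mul23_neq0 1 1)) (negbTE (mul23_neq0 2 2)) (negbTE a_neq0') /=.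
by split=> [[]|].
Qed.

Lemma quartic_to_weierstrass_on_curve z : on_curve iota H z ->
  on_curve iota E (ratmap_app iota quartic_to_weierstrass z).
Proof.
case: z => x y /on_quarticE Hxy; rewrite quartic_to_weierstrassE.
apply/on_weierstrassE; apply/eqP; rewrite -subr_eq0 /W.
have -> : f' = y ^+ 2 - (a' * x ^+ 2 + b' * x + d') ^+ 2 - e' * x.
  by rewrite Hxy; ring.
by apply/eqP; ring.
Qed.

Lemma weierstrass_to_quartic_on_curve z : on_curve iota E z ->
  regular_at iota weierstrass_to_quartic z ->
  on_curve iota H (ratmap_app iota weierstrass_to_quartic z).
Proof.
case: z => u v /on_weierstrassE Euv /weierstrass_to_quartic_regular u_neq.
rewrite weierstrass_to_quarticE; apply/on_quarticE.
have w_neq0 : u - U0 != 0 by rewrite subr_eq0.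
move: Euv; rewrite /n; move: (u - U0) w_neq0 => w w_neq0 Euv.
(* The curve equation is linear in [f']; solving it for [f'] leaves an identity of rational
   functions. *)
have -> : f' = (w ^+ 3 + (9 * b' ^+ 2 - 36 * a' * d') * w ^+ 2
    + 162 * a' * b' * e' * w + (27 * a' * e') ^+ 2 - v ^+ 2)
    / (324 * a' ^+ 2 * w).
  rewrite Euv; field.
  by rewrite w_neq0 a_neq0' (mul23_neq0 2 4).
field.
by rewrite w_neq0 a_neq0' ?(mul23_neq0 2 4) ?(mul23_neq0 1 1) ?(mul23_neq0 2 2).
Qed.

Lemma quartic_to_weierstrassK :
  left_inverse_ratmap iota H quartic_to_weierstrass weierstrass_to_quartic.
Proof.
(* The only affine point that can have [W = 0]: there [y = - (a x^2 + b x + d)], which forces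
   [e x + f = 0]. If [e = 0], then [f != 0] and no such point exists, so the listed pair is
   harmless. *)
exists [:: (- f' / e', - (a' * (- f' / e') ^+ 2 + b' * (- f' / e') + d'))].
move=> [x y] /on_quarticE Hxy; rewrite inE => z_neq.
have W_neq0 : W x y != 0.
  apply: contraNneq z_neq => W0.
  have y_eq : y = - (a' * x ^+ 2 + b' * x + d').
    by apply/eqP; rewrite -subr_eq0 -W0 /W; apply/eqP; ring.
  have res0 : e' * x + f' = 0.
    apply: (addrI ((a' * x ^+ 2 + b' * x + d') ^+ 2)).
    by rewrite addrA -Hxy y_eq; ring.
  have e_neq0 : e' != 0.
    apply/negP; rewrite fmorph_eq0 => /eqP e0.
    have := residual_neq0 e0; rewrite -(fmorph_eq0 iota).
    by move: res0; rewrite /e' e0 rmorph0 mul0r add0r /f' => ->; rewrite eqxx.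
  have x_eq : x = - f' / e'.
    apply: (mulfI e_neq0); rewrite mulrC [RHS]mulrC divfK //.
    by apply/eqP; rewrite mulrC -addr_eq0 res0.
  by rewrite y_eq -x_eq.
have reg : regular_at iota weierstrass_to_quartic
    (ratmap_app iota quartic_to_weierstrass (x, y)).
  rewrite quartic_to_weierstrassE; apply/weierstrass_to_quartic_regular.
  by rewrite -subr_eq0 addrK !mulf_neq0 // (mul23_neq0 1 2).
split=> //; first exact: quartic_to_weierstrass_regular.
have y_eq : y = W x y - (a' * x ^+ 2 + b' * x + d') by rewrite /W; ring.
rewrite quartic_to_weierstrassE weierstrass_to_quarticE /n !addrK.
congr pair; last rewrite [RHS]y_eq.
all: move: (W x y) W_neq0 => w w_neq0; field.
  by rewrite w_neq0 a_neq0' (mul23_neq0 1 1) (mul23_neq0 1 2).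
by rewrite w_neq0 a_neq0' (mul23_neq0 2 4) (mul23_neq0 2 2).
Qed.

Lemma weierstrass_to_quarticK :
  left_inverse_ratmap iota E weierstrass_to_quartic quartic_to_weierstrass.
Proof.
(* The denominators vanish only over [u = U0], where the equation becomes [v^2 = (27 a e)^2]. *)
exists [:: (U0, 27 * a' * e'); (U0, - (27 * a' * e'))].
move=> [u v] /on_weierstrassE Euv; rewrite !inE => z_neq.
have u_neq : u != U0.
  apply: contraNneq z_neq => u_eq; move: Euv.
  rewrite u_eq subrr !expr0n /= !mulr0 !add0r => /eqP.
  by rewrite eqf_sqr !xpair_eqE eqxx.
split; first exact/weierstrass_to_quartic_regular.
  exact: quartic_to_weierstrass_regular.
rewrite weierstrass_to_quarticE quartic_to_weierstrassE /W /n.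
have w_neq0 : u - U0 != 0 by rewrite subr_eq0.
congr pair; first rewrite -[RHS](subrK U0).
all: move: (u - U0) w_neq0 => w w_neq0; field.
  by rewrite w_neq0 a_neq0' (mul23_neq0 1 1) (mul23_neq0 2 2).
by rewrite w_neq0 a_neq0' (mul23_neq0 1 1) (mul23_neq0 2 2).
Qed.

Lemma weierstrass_to_quartic_is_ratmap :
  is_ratmap iota E H weierstrass_to_quartic.
Proof.
split; last exact: weierstrass_to_quartic_on_curve.
by have [s sP] := weierstrass_to_quarticK; exists s => z Ez /(sP z Ez) [].
Qed.

Lemma quartic_to_weierstrass_is_ratmap :
  is_ratmap iota H E quartic_to_weierstrass.
Proof.
split; last by move=> z Hz _; exact: quartic_to_weierstrass_on_curve.
by exists [::] => z _ _; exact: quartic_to_weierstrass_regular.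
Qed.

End Points.

Lemma quartic_birational_reduced : birationally_equivalent H E.
Proof.
exists quartic_to_weierstrass, weierstrass_to_quartic => Omega iota _.
split.
- exact: quartic_to_weierstrass_is_ratmap.
- exact: weierstrass_to_quartic_is_ratmap.
- exact: quartic_to_weierstrassK.
- exact: weierstrass_to_quarticK.
Qed.

End SquareLeadingCoefficient.

Lemma quartic_birational (k : fieldType) (a L M N P : k) :
  2 != 0 :> k -> 3 != 0 :> k -> a != 0 ->
  let A := - 27 * invI (a ^+ 2) L M N P in
  let B := - 27 * invJ (a ^+ 2) L M N P in
  is_elliptic A B ->
  birationally_equivalent (quartic_curve (a ^+ 2) L M N P)
    (weierstrass_curve A B).
Proof.
move=> two_neq0 three_neq0 a_neq0.
(* Chosen so that [(a X^2 + b X + d)^2] matches the three leading coefficients; [e] and [f] are the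
   linear remainder. *)
pose b := L / (2 * a); pose d := (M - b ^+ 2) / (2 * a).
have -> : L = 2 * a * b by rewrite /b; field; apply/andP.
have -> : M = b ^+ 2 + 2 * a * d by rewrite /d; field; apply/andP.
have -> : N = 2 * b * d + (N - 2 * b * d) by ring.
have -> : P = d ^+ 2 + (P - d ^+ 2) by ring.
exact: quartic_birational_reduced.
Qed.

(** * Specialization of elements of a fraction field *)

Section Specialization.
Variables (R : idomainType) (F : fieldType) (ev : {rmorphism R -> F}).

(** [x] lies in the localization of [R] at the kernel of [ev], and [r] is its residue. A relation
    avoids building the local ring. *)
Definition specializes (x : {fraction R}) (r : F) : Prop :=
  exists n d : R, [/\ ev d != 0, x * tofrac d = tofrac n & r * ev d = ev n].

Lemma specializes_tofrac p : specializes (tofrac p) (ev p).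
Proof. by exists p, 1; rewrite !rmorph1 !mulr1 oner_neq0. Qed.

Lemma specializes_nat n : specializes n%:R n%:R.
Proof.
rewrite -(rmorph_nat (@tofrac R)) -(rmorph_nat ev).
exact: specializes_tofrac.
Qed.

Lemma specializesN x r : specializes x r -> specializes (- x) (- r).
Proof.
move=> [n [d [d0 xd rd]]]; exists (- n), d.
by rewrite !rmorphN /= -xd -rd !mulNr.
Qed.

Lemma specializesM x y r s :
  specializes x r -> specializes y s -> specializes (x * y) (r * s).
Proof.
move=> [n [d [d0 xd rd]]] [n' [d' [d0' yd sd]]]; exists (n * n'), (d * d').
rewrite !rmorphM /= -xd -rd -yd -sd mulf_neq0 //.
by split; rewrite // mulrACA.
Qed.

Lemma specializesD x y r s :
  specializes x r -> specializes y s -> specializes (x + y) (r + s).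
Proof.
move=> [n [d [d0 xd rd]]] [n' [d' [d0' yd sd]]].
exists (n * d' + n' * d), (d * d').
rewrite !rmorphD !rmorphM /= -xd -rd -yd -sd mulf_neq0 //.
by split; rewrite //; ring.
Qed.

Lemma specializesB x y r s :
  specializes x r -> specializes y s -> specializes (x - y) (r - s).
Proof. by move=> xr /specializesN; exact: specializesD. Qed.

Lemma specializesX x r n : specializes x r -> specializes (x ^+ n) (r ^+ n).
Proof.
move=> xr; elim: n => [|n IHn]; first exact: (specializes_nat 1).
by rewrite !exprS; exact: specializesM.
Qed.

Lemma specializes_neq0 x r : specializes x r -> r != 0 -> x != 0.
Proof.
move=> [n [d [d0 xd rd]]]; apply: contraNneq => x0; move: xd.
rewrite x0 mul0r => /esym/eqP; rewrite tofrac_eq0 => /eqP n0.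
by move/eqP: rd; rewrite n0 rmorph0 mulf_eq0 (negbTE d0) orbF.
Qed.

Lemma specializesV x r : specializes x r -> r != 0 -> specializes x^-1 r^-1.
Proof.
move=> xr r0; have x0 := specializes_neq0 xr r0.
case: xr => n [d [d0 xd rd]]; exists d, n.
by rewrite -xd -rd mulf_neq0 // !mulKf.
Qed.

Lemma specializes_neq x y r s :
  specializes x r -> specializes y s -> r != s -> x != y.
Proof.
move=> xr ys; rewrite -subr_eq0 -[x == y]subr_eq0.
exact/specializes_neq0/specializesB.
Qed.

(** Lets the value be inferred first from the shape of [x], then compared with the expected one by
    [ring] or [field]. *)
Lemma specializes_eq x r s : specializes x r -> r = s -> specializes x s.
Proof. by move=> xr <-. Qed.

End Specialization.

(** * Lucas sequences and their nonvanishing by parity *)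

Section Lucas.
Variable R : comNzRingType.
Implicit Types c t d : R.

Fixpoint lucas t d (n : nat) : R :=
  match n with
  | 0 => 0
  | 1 => 1
  | (m.+1 as n').+1 => t * lucas t d n' - d * lucas t d m
  end.

Lemma lucasE t d n : lucas t d n.+2 = t * lucas t d n.+1 - d * lucas t d n.
Proof. by []. Qed.

Arguments lucas : simpl never.

(** With weights 1 for [t] and 2 for [d], term [n.+1] is homogeneous of weight [n]; this serves to
    clear denominators. *)
Lemma lucasZ c t d n :
  lucas (c * t) (c ^+ 2 * d) n.+1 = c ^+ n * lucas t d n.+1.
Proof.
suff [] : lucas (c * t) (c ^+ 2 * d) n.+1 = c ^+ n * lucas t d n.+1 /\
          lucas (c * t) (c ^+ 2 * d) n.+2 = c ^+ n.+1 * lucas t d n.+2 by [].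
elim: n => [|n [IH1 IH2]]; first by rewrite /lucas; split; ring.
by split=> //; rewrite lucasE IH1 IH2 [in RHS]lucasE !exprS; ring.
Qed.

Lemma lucas10 n : lucas 1 0 n.+1 = 1.
Proof. by elim: n => // n IHn; rewrite lucasE IHn; ring. Qed.

End Lucas.

Arguments lucas : simpl never.

Lemma rmorph_lucas (R S : comNzRingType) (h : {rmorphism R -> S}) t d n :
  h (lucas t d n) = lucas (h t) (h d) n.
Proof.
suff [] : h (lucas t d n) = lucas (h t) (h d) n /\
          h (lucas t d n.+1) = lucas (h t) (h d) n.+1 by [].
elim: n => [|n [IH1 IH2]]; first by rewrite /lucas rmorph0 rmorph1.
by split=> //; rewrite lucasE rmorphB !rmorphM IH1 IH2.
Qed.

(** Modulo 2 the parameters become [1] and [0], whose sequence is constantly [1] from index 1 on. *)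
Lemma lucas_odd_neq0 (s u : int) n : lucas (2 * s + 1) (2 * u) n.+1 != 0.
Proof.
apply/eqP => /(congr1 (intr : int -> 'F_2)) /eqP.
have two0 : 2 = 0 :> 'F_2 by apply: val_inj.
rewrite rmorph_lucas rmorphD !rmorphM rmorph_nat two0 !mul0r add0r rmorph1.
by rewrite lucas10 rmorph0 oner_eq0.
Qed.

Lemma lucas_scaled_odd_neq0 (F : numFieldType) (k : F) (s u : int) n :
  k != 0 -> lucas (k * (2 * s + 1)%:~R) (k ^+ 2 * (2 * u)%:~R) n.+1 != 0.
Proof.
move=> k0; rewrite lucasZ -rmorph_lucas mulf_neq0 ?expf_neq0 //.
by rewrite intr_eq0 lucas_odd_neq0.
Qed.

(** * Group law under reduction to a nodal cubic *)

Section NodalReduction.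
Variables (R : idomainType) (F : fieldType) (ev : {rmorphism R -> F}).
Variables (A : {fraction R}) (alpha : F).
Hypothesis two_neq0 : 2 != 0 :> F.
Hypothesis A_spec : specializes ev A (- 3 * alpha ^+ 2).

Notation spec := (specializes ev).

(* The nodal cubic [y^2 = (x - alpha)^2 (x + 2 alpha)] is parametrized by
   [z = y / (x - alpha)], the slope of the line through the node. *)
Definition reduces_to (p : ec_point {fraction R}) (z : F) : Prop :=
  if p is Some (x, y) then
    spec x (z ^+ 2 - 2 * alpha) /\ spec y (z * (z ^+ 2 - 3 * alpha))
  else False.

(** Common to chord and tangent: each case is left with two identities over [F], for the abscissa
    and the ordinate. *)
Lemma ec_chord_reduces slope x1 y1 x2 l z1 z2 z3 :
  spec slope l -> reduces_to (Some (x1, y1)) z1 ->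
  spec x2 (z2 ^+ 2 - 2 * alpha) ->
  l ^+ 2 - z1 ^+ 2 - z2 ^+ 2 + 6 * alpha = z3 ^+ 2 ->
  l * (z1 ^+ 2 - z3 ^+ 2) - z1 * (z1 ^+ 2 - 3 * alpha)
    = z3 * (z3 ^+ 2 - 3 * alpha) ->
  reduces_to (ec_chord slope x1 y1 x2) z3.
Proof.
move=> ls [xs ys] xs2 x3E y3E; rewrite /ec_chord /=.
have xs3 : spec (slope ^+ 2 - x1 - x2) (z3 ^+ 2 - 2 * alpha).
  apply: specializes_eq (specializesB
    (specializesB (specializesX 2 ls) xs) xs2) _.
  by rewrite -x3E; ring.
split=> //.
apply: specializes_eq (specializesB (specializesM
  ls (specializesB xs xs3)) ys) _.
by rewrite -y3E; ring.
Qed.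

(** The abscissae reduce to values differing by [(z2 - z1) (z1 + z2)], so they are distinct and the
    chord branch is taken. With [s^2 = 3 alpha], the law says that [(z + s) / (z - s)] is
    multiplicative. *)
Lemma ec_add_reduces p q z1 z2 :
  reduces_to p z1 -> reduces_to q z2 -> z1 != z2 -> z1 + z2 != 0 ->
  reduces_to (ec_add A p q) ((z1 * z2 + 3 * alpha) / (z1 + z2)).
Proof.
case: p => [[x1 y1]|] // [xs1 ys1]; case: q => [[x2 y2]|] // [xs2 ys2] nz sz.
have z21 : z2 - z1 != 0 by rewrite subr_eq0 eq_sym.
have den0 : z2 ^+ 2 - 2 * alpha - (z1 ^+ 2 - 2 * alpha) != 0.
  have -> : z2 ^+ 2 - 2 * alpha - (z1 ^+ 2 - 2 * alpha) = (z2 - z1) * (z1 + z2).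
    by ring.
  by rewrite mulf_neq0.
rewrite /= (specializes_neq xs1 xs2); last first.
  by rewrite eq_sym -subr_eq0.
have slopes := specializesM (specializesB ys2 ys1)
  (specializesV (specializesB xs2 xs1) den0).
have p1 : reduces_to (Some (x1, y1)) z1 by [].
apply: (ec_chord_reduces slopes p1 xs2).
  by field; rewrite sz den0.
by field; rewrite sz den0.
Qed.

(** [2 y] reduces to [2 z (z^2 - 3 alpha)], whose nonvanishing selects the tangent branch;
    [z^2 = 3 alpha] is the node itself. *)
Lemma ec_double_reduces p z :
  reduces_to p z -> z != 0 -> z ^+ 2 != 3 * alpha ->
  reduces_to (ec_add A p p) ((z ^+ 2 + 3 * alpha) / (2 * z)).
Proof.
case: p => [[x y]|] // [xs ys] z0 zD.
have zD0 : z ^+ 2 - 3 * alpha != 0 by rewrite subr_eq0.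
have den0 : 2 * (z * (z ^+ 2 - 3 * alpha)) != 0 by rewrite !mulf_neq0.
rewrite /= eqxx /= (negbTE (specializes_neq ys
  (specializesN ys) _)); last first.
  by rewrite -subr_eq0 opprK -[X in X + _]mul1r -[X in _ + X]mul1r -mulrDl.
have nats := specializes_nat ev.
have slopes := specializesM
  (specializesD
    (specializesM (nats 3) (specializesX 2 xs)) A_spec)
  (specializesV (specializesM (nats 2) ys) den0).
have p1 : reduces_to (Some (x, y)) z by [].
apply: (ec_chord_reduces slopes p1 xs).
  by field; rewrite z0 two_neq0 zD0.
by field; rewrite z0 two_neq0 zD0.
Qed.

(** If [z'] is the parameter of a multiple and [w = z' + z], adding [p] sends [w] to
    [2 z - (z^2 - 3 alpha) / w]. This is the recurrence for ratios of consecutive Lucas terms. *)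
Lemma ec_iter_reduces p z n :
  reduces_to p z -> z ^+ 2 != 3 * alpha ->
  let q := lucas (2 * z) (z ^+ 2 - 3 * alpha) in
  (forall m, q m.+1 != 0) ->
  reduces_to (iter n.+1 (ec_add A p) None) (q n.+2 / q n.+1 - z).
Proof.
move=> pz zD q q0.
have q1 : q 1%N = 1 by [].
have q2 : q 2%N = 2 * z by rewrite /q /lucas; ring.
have z0 : z != 0 by have := q0 1%N; rewrite q2 mulf_eq0 negb_or => /andP[].
have qE m : q m.+2 = 2 * z * q m.+1 - (z ^+ 2 - 3 * alpha) * q m by [].
have pN : ec_add A p None = p by case: (p) => [[]|].
(* The three cases are [p] itself, its double, and a chord addition to a later multiple. *)
elim: n => [|[|n] IHn].
- by rewrite /= pN q2 q1 divr1 mulr_natl mulr2n addrK.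
- rewrite /= pN; have -> : q 3%N / q 2%N - z = (z ^+ 2 + 3 * alpha) / (2 * z).
    by rewrite qE q2 q1; field; rewrite z0.
  exact: ec_double_reduces.
rewrite iterS; have q0' := q0 n.+1.
have -> : q n.+4 / q n.+3 - z = (z * (q n.+3 / q n.+2 - z) + 3 * alpha)
    / (z + (q n.+3 / q n.+2 - z)).
  rewrite (qE n.+2); field.
  by rewrite q0 mulNr addrCA subrr addr0 q0.
(* The difference of the two parameters is, up to sign, [(z^2 - 3 alpha) q_(n+1) / q_(n+2)], and
   their sum is [q_(n+3) / q_(n+2)]. *)
apply: ec_add_reduces => //.
  rewrite eq_sym -subr_eq0 qE.
  have -> : (2 * z * q n.+2 - (z ^+ 2 - 3 * alpha) * q n.+1) / q n.+2 - z - z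
      = - ((z ^+ 2 - 3 * alpha) * q n.+1 / q n.+2) by field.
  by rewrite oppr_eq0 !mulf_neq0 ?invr_neq0 // subr_eq0.
by rewrite addrC subrK mulf_neq0 ?invr_neq0.
Qed.

End NodalReduction.

(** Since [reduces_to] excludes [None], no positive multiple of [p] is zero; negative ones are
    opposites of these. *)
Lemma ec_rank_ge1_nodal (R : idomainType) (F : fieldType)
    (ev : {rmorphism R -> F}) (A B : {fraction R}) (alpha z : F) p :
  2 != 0 :> F -> specializes ev A (- 3 * alpha ^+ 2) ->
  ec_rational A B p -> reduces_to ev alpha p z -> z ^+ 2 != 3 * alpha ->
  (forall n, lucas (2 * z) (z ^+ 2 - 3 * alpha) n.+1 != 0) ->
  ec_rank_ge A B 1.
Proof.
move=> two_neq0 As p_rat pz zD q0; exists (fun=> p); split=> // m.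
rewrite big_ord_recl big_ord0 => pm i; rewrite (ord1 i).
have {pm} : ec_mulz A (m ord0) p = None.
  by move: pm; case: (ec_mulz _ _ _) => [[]|].
have mulP n := ec_iter_reduces two_neq0 As n pz zD q0.
case: (m ord0) => [[|n]|n] //= pn; have := mulP n; rewrite iterS.
  by rewrite pn.
by case: (ec_add _ _ _) pn => [[]|].
Qed.

(** * The coefficients at a nodal and at a smooth specialization *)

Ltac specialize_terms := repeat match goal with
  | H : specializes _ ?x _ |- specializes _ ?x _ => exact: H
  | |- specializes _ (_ + _) _ => apply: specializesD
  | |- specializes _ (- _) _ => apply: specializesN
  | |- specializes _ (_ * _) _ => apply: specializesM
  | |- specializes _ (_ ^+ _) _ => apply: specializesX
  | |- specializes _ 1 _ => exact: (specializes_nat _ 1)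
  | |- specializes _ (_ *+ _) _ => exact: specializes_nat
  end.

Section SpecializeCoefficients.
Variables (R : idomainType) (F : fieldType) (ev : {rmorphism R -> F}).
Variables (c v : {fraction R}) (c0 v0 : F).
Hypotheses (cs : specializes ev c c0) (vs : specializes ev v v0).

Lemma specializes_coeff_K : specializes ev (coeff_K c) (coeff_K c0).
Proof. by rewrite /coeff_K; specialize_terms. Qed.

Lemma specializes_coeff_L : specializes ev (coeff_L c v) (coeff_L c0 v0).
Proof. by rewrite /coeff_L; specialize_terms. Qed.

Lemma specializes_coeff_M : specializes ev (coeff_M c v) (coeff_M c0 v0).
Proof. by rewrite /coeff_M; specialize_terms. Qed.

Lemma specializes_coeff_N : specializes ev (coeff_N c v) (coeff_N c0 v0).
Proof. by rewrite /coeff_N; specialize_terms. Qed.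

Lemma specializes_coeff_P : specializes ev (coeff_P c v) (coeff_P c0 v0).
Proof. by rewrite /coeff_P; specialize_terms. Qed.

End SpecializeCoefficients.

(** Here [K = P], [L = N] and [2 K + 2 L + M = 0], so the quartic has a double root at [X = 1],
    whence the node. *)
Lemma coeff_values_nodal :
  let c : rat := - 1 / 2 in
  [/\ coeff_K c = (819%:R / 512%:R) ^+ 2,
      coeff_L c 0 = - (111432321%:R / 8192%:R),
      coeff_M c 0 = 3565163511%:R / 131072%:R,
      coeff_N c 0 = - (111432321%:R / 8192%:R)
    & coeff_P c 0 = (819%:R / 512%:R) ^+ 2].
Proof.
split.
- by rewrite /coeff_K; field.
- by rewrite /coeff_L; field.
- by rewrite /coeff_M; field.
- by rewrite /coeff_N; field.
- by rewrite /coeff_P; field.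
Qed.

(** The discriminant vanishes at [(-1/2, 0)], so ellipticity is tested at [(0, 2)], where the
    quartic is [84^2 (X^4 - 16 X^3 + 66 X^2 - 80 X + 1)]. *)
Lemma coeff_values_smooth :
  let c : rat := 0 in
  [/\ coeff_K c = 7056%:R, coeff_L c 2 = - 112896%:R,
      coeff_M c 2 = 465696%:R, coeff_N c 2 = - 564480%:R
    & coeff_P c 2 = 7056%:R].
Proof.
split.
- by rewrite /coeff_K; ring.
- by rewrite /coeff_L; ring.
- by rewrite /coeff_M; ring.
- by rewrite /coeff_N; ring.
- by rewrite /coeff_P; ring.
Qed.

(** The point is [(3 (b^2 - 4 a d), 27 a e)], freed of divisions by [2 a d = M - b^2] and
    [e = N - 2 b d]. *)
Lemma weierstrass_point_on_curve (R : comNzRingType) (a b M N P : R) :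
  let A := - 27 * invI (a ^+ 2) (2 * a * b) M N P in
  let B := - 27 * invJ (a ^+ 2) (2 * a * b) M N P in
  let x := 3 * (3 * b ^+ 2 - 2 * M) in
  let y := 27 * (a * N - b * (M - b ^+ 2)) in
  y ^+ 2 = x ^+ 3 + A * x + B.
Proof. by rewrite /invI /invJ /=; ring. Qed.

Lemma ratio_neq0 (R : numFieldType) m n : m.+1%:R / n.+1%:R != 0 :> R.
Proof. by rewrite mulf_neq0 ?invr_eq0 ?pnatr_eq0. Qed.

Section SmoothSpecialization.
Variables (R : idomainType) (F : numFieldType) (ev : {rmorphism R -> F}).
Variables K L M N P : {fraction R}.
Hypothesis K_spec : specializes ev K 7056%:R.
Hypothesis L_spec : specializes ev L (- 112896%:R).
Hypothesis M_spec : specializes ev M 465696%:R.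
Hypothesis N_spec : specializes ev N (- 564480%:R).
Hypothesis P_spec : specializes ev P 7056%:R.

Lemma is_elliptic_of_smooth_specialization :
  is_elliptic (- 27 * invI K L M N P) (- 27 * invJ K L M N P).
Proof.
rewrite /is_elliptic; set D := (X in X != 0).
(* The value at the smooth point, factored so that it is nonzero factor by factor. *)
have D_spec : specializes ev D (- (2 ^+ 44 * 3 ^+ 24 * 7 ^+ 12 * 17%:R)).
  apply: specializes_eq; first by rewrite /D /invI /invJ; specialize_terms.
  by ring.
apply: (specializes_neq0 D_spec).
by rewrite oppr_eq0 !mulf_neq0 ?expf_neq0 ?pnatr_eq0.
Qed.

End SmoothSpecialization.

(* The values of [alpha] and [z] at [(c, v) = (-1/2, 0)]. *)
Definition node : rat := - (2672363421%:R / 65536%:R).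
Definition slope : rat := - (3262959%:R / 256%:R).

(* Dividing by the scaling factor [- 63 / 128] leaves the odd integer [51793]
   and the even integer [12958 * 51793] as parameters of the Lucas sequence. *)
Lemma slope_trace : 2 * slope = - (63%:R / 128%:R) * (2 * 25896%:R + 1)%:~R.
Proof. by rewrite /slope; field. Qed.

Lemma slope_norm : slope ^+ 2 - 3 * node
  = (- (63%:R / 128%:R)) ^+ 2 * (2 * (6479%:R * 51793%:R))%:~R.
Proof. by rewrite /slope /node; field. Qed.

Lemma slope_neq_node : slope ^+ 2 != 3 * node.
Proof.
rewrite -subr_eq0 slope_norm; apply: mulf_neq0.
  by apply: expf_neq0; rewrite oppr_eq0 ratio_neq0.
rewrite intr_eq0; apply: mulf_neq0; first by rewrite pnatr_eq0.
by apply: mulf_neq0; rewrite pnatr_eq0.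
Qed.

Lemma lucas_slope_neq0 n : lucas (2 * slope) (slope ^+ 2 - 3 * node) n.+1 != 0.
Proof.
rewrite slope_trace slope_norm; apply: lucas_scaled_odd_neq0.
by rewrite oppr_eq0 ratio_neq0.
Qed.

Section NodalSpecialization.
Variables (R : idomainType) (ev : {rmorphism R -> rat}).
Variables a b M N P : {fraction R}.
Hypothesis a_spec : specializes ev a (819%:R / 512%:R).
Hypothesis b_spec : specializes ev b (- (136059%:R / 32%:R)).
Hypothesis M_spec : specializes ev M (3565163511%:R / 131072%:R).
Hypothesis N_spec : specializes ev N (- (111432321%:R / 8192%:R)).
Hypothesis P_spec : specializes ev P ((819%:R / 512%:R) ^+ 2).

Lemma ec_rank_ge1_of_nodal_specialization :
  ec_rank_ge (- 27 * invI (a ^+ 2) (2 * a * b) M N P)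
    (- 27 * invJ (a ^+ 2) (2 * a * b) M N P) 1.
Proof.
pose p := Some (3 * (3 * b ^+ 2 - 2 * M), 27 * (a * N - b * (M - b ^+ 2))).
apply: (@ec_rank_ge1_nodal _ _ ev _ _ node slope p).
- by rewrite pnatr_eq0.
- apply: specializes_eq; first by rewrite /invI; specialize_terms.
  by rewrite /node; field.
- exact: weierstrass_point_on_curve.
- split; (apply: specializes_eq; first by specialize_terms).
    by rewrite /node /slope; field.
  by rewrite /node /slope; field.
- exact: slope_neq_node.
exact: lucas_slope_neq0.
Qed.

End NodalSpecialization.

(** * Evaluation at rational points and assembly of the theorem *)

Definition eval_cv (c v : rat) : {rmorphism {poly {poly rat}} -> rat} :=
  horner_eval c \o horner_eval v%:P.

Lemma specializes_indet_c c v : specializes (eval_cv c v) indet_c c.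
Proof.
apply: specializes_eq (specializes_tofrac _ _) _.
by rewrite /= /horner_eval hornerC hornerX.
Qed.

Lemma specializes_indet_v c v : specializes (eval_cv c v) indet_v v.
Proof.
apply: specializes_eq (specializes_tofrac _ _) _.
by rewrite /= /horner_eval hornerX hornerC.
Qed.

Theorem theorem3p3 :
  let K : Qcv := coeff_K indet_c in
  let L : Qcv := coeff_L indet_c indet_v in
  let M : Qcv := coeff_M indet_c indet_v in
  let N : Qcv := coeff_N indet_c indet_v in
  let P : Qcv := coeff_P indet_c indet_v in
  let A : Qcv := - 27 * invI K L M N P in
  let B : Qcv := - 27 * invJ K L M N P in
  [/\ is_elliptic A B,
      birationally_equivalent (quartic_curve K L M N P) (weierstrass_curve A B)
    & ec_rank_ge A B 1].
Proof.
move=> K L M N P.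
pose a : Qcv := (indet_c + 1) * (3 * indet_c ^+ 2 + 3 * indet_c + 1)
  * (3 * indet_c ^+ 2 + 6 * indet_c + 4) * (3 * indet_c ^+ 2 + 9 * indet_c + 7)
  * (indet_c ^+ 2 + 2 * indet_c + 3).
have K_sqr : K = a ^+ 2 by [].
have cv_spec c v : [/\ specializes (eval_cv c v) K (coeff_K c),
    specializes (eval_cv c v) L (coeff_L c v),
    specializes (eval_cv c v) M (coeff_M c v),
    specializes (eval_cv c v) N (coeff_N c v)
    & specializes (eval_cv c v) P (coeff_P c v)].
  have c_spec := specializes_indet_c c v.
  have v_spec := specializes_indet_v c v.
  split; [exact: specializes_coeff_K | exact: specializes_coeff_L
    | exact: specializes_coeff_M | exact: specializes_coeff_N
    | exact: specializes_coeff_P].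
have a_spec : specializes (eval_cv (- 1 / 2) 0) a (819%:R / 512%:R).
  apply: specializes_eq.
    have c_spec := specializes_indet_c (- 1 / 2) 0.
    by rewrite /a; specialize_terms.
  by field.
(* From here on only [K = a^2] and the specializations matter, so the large polynomials are made
   opaque. *)
clearbody K L M N P a; rewrite {}K_sqr in cv_spec * => A B.
have Qcv_nat n : n.+1%:R != 0 :> Qcv.
  apply: (specializes_neq0 (specializes_nat (eval_cv 0 0) n.+1)).
  by rewrite pnatr_eq0.
have a_neq0 : a != 0 by apply: (specializes_neq0 a_spec); exact: ratio_neq0.
have AB_elliptic : is_elliptic A B.
  have := cv_spec 0 2; have [-> -> -> -> ->] := coeff_values_smooth.
  by case; exact: is_elliptic_of_smooth_specialization.
split; first exact: AB_elliptic.
  exact: quartic_birational (Qcv_nat 1%N) (Qcv_nat 2%N) a_neq0 AB_elliptic.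
have := cv_spec (- 1 / 2) 0; have [-> -> -> -> ->] := coeff_values_nodal.
rewrite /A /B; clear A B AB_elliptic cv_spec.
move=> [_ L_spec M_spec N_spec P_spec].
have two_a_neq0 : 2 * a != 0.
  by apply: mulf_neq0 a_neq0; exact: (Qcv_nat 1%N).
have b_spec : specializes (eval_cv (- 1 / 2) 0) (L / (2 * a))
    (- (136059%:R / 32%:R)).
  apply: specializes_eq.
    apply: specializesM L_spec _; apply: specializesV.
      by apply: specializesM a_spec; exact: specializes_nat.
    by rewrite mulf_neq0 ?ratio_neq0 ?pnatr_eq0.
  by field.
(* Brings [L] to the form [2 a b] with [b = L / (2 a)]. *)
rewrite -[L](divfK two_a_neq0) [_ / _ * _]mulrC.
exact: ec_rank_ge1_of_nodal_specialization a_spec b_spec M_spec N_spec P_spec.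
Qed.
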